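(* Let $\Sigma$ be a closed, connected, oriented surface and $L\subset\Sigma\times I$ an oriented link with spanning surface $F\subset\Sigma\times I$. Then the signature, determinant, and nullity of the vertical mirror image $L^*$ (with spanning surface $F_\varphi$) and the horizontal mirror image $L^\dagger$ (with spanning surface $F_\psi$) satisfy $$\sigma(L^*,F_\varphi)=-\sigma(L,F),\qquad \sigma(L^\dagger,F_\psi)=-\sigma(L,F),$$ $$\det(L^*,F_\varphi)=\det(L,F),\qquad \det(L^\dagger,F_\psi)=\det(L,F),$$ $$n(L^*,F_\varphi)=n(L,F),\qquad n(L^\dagger,F_\psi)=n(L,F).$$
   Context: $I=[0,1]$, $p\colon\Sigma\times I\to\Sigma$ is the projection. A spanning surface for $L$ is a compact surface $F\subset\Sigma\times I$ with $\partial F=L$ and no closed components. Mirror images: $\varphi(x,t)=(x,1-t)$ and $\psi(x,t)=(f(x),t)$, where $f\colon\Sigma\to\Sigma$ is an orientation reversing homeomorphism. $L^*=\varphi(L)$, $F_\varphi=\varphi(F)$, $L^\dagger=\psi(L)$, $F_\psi=\psi(F)$ (with induced orientations on the links). For disjoint oriented $J,K\subset\Sigma\times I$, $\ell k_\Sigma(J,K)$ is the signed count of crossings where $J$ passes over $K$ (equivalently $J\cdot B$ for a 2-chain $B$ with $\partial B=K+c$, $c$ a 1-cycle in $\Sigma\times\{1\}$). A closed tubular neighborhood of $F$ is a $[-1,1]$-bundle over $F$; let $\widetilde F\to F$ be the associated $\{\pm1\}$-bundle and $\tau\colon H_1(F;\mathbb Z)\to H_1(\widetilde F;\mathbb Z)$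 the transfer. The Gordon-Litherland pairing is $\mathcal G_F(\alpha,\beta)=\ell k_\Sigma(\tau\alpha,\beta)-p_*(\alpha)\cdot p_*(\beta)$ on $H_1(F;\mathbb Z)$. With $L'$ the push-off of $L$ missing $F$ (parallel given by the framing induced by $F$, oriented parallel to $L$), $e(F,L)=-\ell k_\Sigma(L,L')$. Then $\sigma(L,F)=\operatorname{sig}(\mathcal G_F)+\tfrac12e(F,L)$, and for connected $F$, $\det(L,F)=|\det(\mathcal G_F)|$ and $n(L,F)=\operatorname{nul}(\mathcal G_F)$. (For disconnected $F$ the nullity is $n(L,F)=\operatorname{nul}(\mathcal G_F)+b_0(F)-1$.) *)

(* Defs.v *)
From HB Require Import structures.
From mathcomp Require Import all_boot all_order all_algebra all_field.
From mathcomp Require Import spectral.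
From mathcomp Require Import all_classical all_reals all_analysis.
From mathcomp.multinomials Require Import freeg.

Set Implicit Arguments.
Unset Strict Implicit.
Unset Printing Implicit Defensive.
Import Order.TTheory GRing.Theory Num.Theory.
Import numFieldNormedType.Exports.
Local Open Scope classical_set_scope.
Local Open Scope ring_scope.

(* Definite description: the element of P if P is a singleton, x0 otherwise. *)
Definition the (T : choiceType) (x0 : T) (P : set T) : T :=
  xget x0 [set x | P = [set x]].

Definition open_embedding (X Y : topologicalType) (c : X -> Y) : Prop :=
  [/\ continuous c, injective c & forall U, open U -> open (c @` U)].

Definition homeomorphism (X Y : topologicalType) (f : X -> Y) : Prop :=
  continuous f /\
  exists g : Y -> X, [/\ continuous g, cancel f g & cancel g f].

Section SingularHomology.
Variable R : realType.

Definition clamp (t : R) : R := Num.max 0 (Num.min 1 t).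

(* Singular 1-simplices of A: a path parametrized by [0,1] is represented by
   its unique extension to R that is constant on both sides of [0,1], so that
   equality of paths is equality of functions. *)
Definition path_in (X : topologicalType) (A : set X) (g : R -> X) : Prop :=
  [/\ continuous g, g \o clamp = g & forall t, A (g t)].

Definition loop_in (X : topologicalType) (A : set X) (g : R -> X) : Prop :=
  path_in A g /\ g 0 = g 1.

(* The standard 2-simplex, with ordered vertices (0,0), (0,1), (1,1). *)
Definition triangle : set (R * R) := [set z | 0 <= z.1 <= z.2 /\ z.2 <= 1].

Definition simplex2_in (X : topologicalType) (A : set X) (g : R * R -> X) :
    Prop :=
  {within triangle, continuous g} /\ forall z, triangle z -> A (g z).

Definition bd1 (X : topologicalType) (c : {freeg (R -> X) / int}) :
    {freeg X / int} :=
  fglift (fun g : R -> X => << g 1 >> - << g 0 >>) c.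

Definition bd2 (X : topologicalType) (c : {freeg (R * R -> X) / int}) :
    {freeg (R -> X) / int} :=
  fglift (fun g : R * R -> X =>
    << (fun t => g (clamp t, 1)) >> - << (fun t => g (clamp t, clamp t)) >>
    + << (fun t => g (0, clamp t)) >>) c.

Definition cycle1 (X : topologicalType) (A : set X)
    (c : {freeg (R -> X) / int}) : Prop :=
  (forall g, g \in dom c -> path_in A g) /\ bd1 c = 0.

Definition boundary1 (X : topologicalType) (A : set X)
    (c : {freeg (R -> X) / int}) : Prop :=
  exists d : {freeg (R * R -> X) / int},
    (forall g, g \in dom d -> simplex2_in A g) /\ bd2 d = c.

Definition push (X Y : topologicalType) (h : X -> Y)
    (c : {freeg (R -> X) / int}) : {freeg (R -> Y) / int} :=
  fglift (fun g : R -> X => << h \o g >>) c.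

(* The classes of the cycles b i form a Z-basis of H_1(A; Z). *)
Definition H1_basis (X : topologicalType) (A : set X) (r : nat)
    (b : 'I_r -> {freeg (R -> X) / int}) : Prop :=
  (forall i, cycle1 A (b i)) /\
  forall z, cycle1 A z ->
    exists! m : {ffun 'I_r -> int}, boundary1 A (z - \sum_i b i *~ m i).

(* On cycles, l induces a bilinear pairing H_1(A) x H_1(B) -> Z. *)
Definition H1_pairing (X : topologicalType) (A B : set X)
    (l : {freeg (R -> X) / int} -> {freeg (R -> X) / int} -> int) : Prop :=
  [/\ forall a a' b, cycle1 A a -> cycle1 A a' -> cycle1 B b ->
        l (a + a') b = l a b + l a' b,
      forall a b b', cycle1 A a -> cycle1 B b -> cycle1 B b' ->
        l a (b + b') = l a b + l a b',
      forall a b, boundary1 A a -> cycle1 B b -> l a b = 0 &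
      forall a b, cycle1 A a -> boundary1 B b -> l a b = 0].

(* If q restricts to a double covering of A by C, this is the transfer
   H_1(A) -> H_1(C): a path is sent to the sum of its two lifts. *)
Definition transfer (X : topologicalType) (C : set X) (q : X -> X)
    (c : {freeg (R -> X) / int}) : {freeg (R -> X) / int} :=
  fglift (fun g : R -> X =>
    \sum_(h \in [set h | path_in C h /\ q \o h = g])
      (<< h >> : {freeg (R -> X) / int})) c.

End SingularHomology.

Section Surfaces.
Variables (R : realType) (S : topologicalType).

Definition closed_connected_surface : Prop :=
  [/\ hausdorff_space S, compact [set: S], connected [set: S] &
      forall x : S, exists c : R * R -> S, open_embedding c /\ range c x].

(* An orientation of S, given as the set O of positively oriented charts: O
   selects exactly one of each chart and its reflection, and being in O is
   invariant under isotopy of charts.  Only the restriction of O to open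
   embeddings of R^2 matters. *)
Definition orientation (O : set (R * R -> S)) : Prop :=
  (forall c, open_embedding c ->
     (O c <-> ~ O (fun v => c (v.1, - v.2)))) /\
  (forall H : R -> R * R -> S,
     continuous (fun z : R * (R * R) => H z.1 z.2) ->
     (forall t, open_embedding (H t)) -> (O (H 0) <-> O (H 1))).

Definition orientation_reversing (O : set (R * R -> S)) (f : S -> S) : Prop :=
  forall c : R * R -> S, open_embedding c -> (O (f \o c) <-> ~ O c).

(* At the parameters (s, t) the paths g and h of S cross transversally with
   sign e: some positive chart takes g to the first axis and h to the second
   one, the latter traversed in the direction e. *)
Definition crossing (O : set (R * R -> S)) (g h : R -> S) (s t : R) (e : int) :
    Prop :=
  [/\ 0 < s < 1, 0 < t < 1, e = 1 \/ e = -1 &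
      exists c : R * R -> S, exists eta : R,
        [/\ open_embedding c, O c, 0 < eta &
            forall u, `|u| < eta ->
              g (s + u) = c (u, 0) /\ h (t + u) = c (0, e%:~R * u)]].

(* g and h are in general position: X lists all coincidences of g and h, each
   of them a transverse crossing, and e gives their signs. *)
Definition crossings (O : set (R * R -> S)) (g h : R -> S)
    (X : seq (R * R)) (e : R * R -> int) : Prop :=
  [/\ uniq X,
      forall s t, 0 <= s <= 1 -> 0 <= t <= 1 ->
        (g s = h t <-> (s, t) \in X) &
      forall x, x \in X -> crossing O g h x.1 x.2 (e x)].

(* The intersection form of H_1(S): it is the signed number of crossings for
   loops in general position, which determines it. *)
Definition intersection_form (O : set (R * R -> S))
    (d : {freeg (R -> S) / int} -> {freeg (R -> S) / int} -> int) : Prop :=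
  [/\ H1_pairing [set: S] [set: S] d,
      forall a b, cycle1 [set: S] a -> cycle1 [set: S] b -> d a b = - d b a &
      forall g h X e, loop_in [set: S] g -> loop_in [set: S] h ->
        crossings O g h X e -> d << g >> << h >> = \sum_(x <- X) e x].

(* Links and surfaces lie in S x [0,1], while their neighborhoods and push-offs
   are allowed to be in S x R: nothing then has to be assumed about how the
   surface meets S x {0,1}. *)
Definition thickened : set (S * R) := [set z | 0 <= z.2 <= 1].

(* The linking number of disjoint cycles: for loops in general position it is
   the signed number of crossings where the first loop passes over the second,
   and it only depends on homology classes in disjoint sets; this determines
   it. *)
Definition linking_form (O : set (R * R -> S))
    (l : {freeg (R -> S * R) / int} -> {freeg (R -> S * R) / int} -> int) :
    Prop :=
  (forall A B : set (S * R), A `&` B = set0 -> H1_pairing A B l) /\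
  (forall (A B : set (S * R)) g h X e, A `&` B = set0 ->
     loop_in A g -> loop_in B h -> crossings O (fst \o g) (fst \o h) X e ->
     l << g >> << h >> =
       \sum_(x <- X | ((h x.2).2 < (g x.1).2)%R) e x).

(* An oriented link, each component being parametrized, with its orientation,
   by a simple loop. *)
Definition oriented_link (n : nat) (L : 'I_n -> R -> S * R) : Prop :=
  (forall i, loop_in thickened (L i)) /\
  (forall i j s t, 0 <= s < 1 -> 0 <= t < 1 -> L i s = L j t ->
     i = j /\ s = t).

Definition link_set (n : nat) (L : 'I_n -> R -> S * R) : set (S * R) :=
  [set z | exists i t, z = L i t].

(* F is a compact locally flat surface with boundary L, in which every
   component has a boundary point. *)
Definition spanning_surface (n : nat) (L : 'I_n -> R -> S * R)
    (F : set (S * R)) : Prop :=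
  [/\ compact F, F `<=` thickened,
      forall x, F x -> ~ link_set L x ->
        exists c : R * R * R -> S * R,
          [/\ open_embedding c, range c x &
              forall v, F (c v) <-> v.2 = 0],
      forall x, link_set L x ->
        exists c : R * R * R -> S * R,
          [/\ open_embedding c, range c x,
              forall v, F (c v) <-> (v.2 = 0 /\ 0 <= v.1.2) &
              forall v, link_set L (c v) <-> (v.2 = 0 /\ v.1.2 = 0)] &
      forall x, F x -> connected_component F x `&` link_set L !=set0].

(* A closed tubular neighborhood of F, as a [-1,1]-bundle with structure group
   {1,-1}: Ft is the {1,-1}-bundle, and E z restricted to [0,1] parametrizes the
   half-fibre from the point E z 0 of F to the point z = E z 1 of Ft.  Two
   half-fibres over the same point of F meet at that point only. *)
Definition tubular_neighborhood (F Ft : set (S * R)) (E : S * R -> R -> S * R) :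
    Prop :=
  [/\ compact Ft,
      {within [set w : (S * R) * R | Ft w.1 /\ 0 <= w.2 <= 1],
        continuous (fun w => E w.1 w.2)},
      forall z, Ft z -> E z 1 = z /\ F (E z 0),
      forall z z' t t', Ft z -> Ft z' -> 0 <= t <= 1 -> 0 <= t' <= 1 ->
        E z t = E z' t' -> t = t' /\ (t = 0 \/ z = z') &
      forall x, F x -> exists U : set (S * R), exists sp sm : S * R -> S * R,
        [/\ open U /\ U x,
            {within F `&` U, continuous sp} /\ {within F `&` U, continuous sm},
            forall y, F y -> U y ->
              [/\ Ft (sp y), Ft (sm y), E (sp y) 0 = y & E (sm y) 0 = y] /\
              sp y <> sm y &
            forall z, Ft z -> U (E z 0) ->
              z = sp (E z 0) \/ z = sm (E z 0)]].

(* L' is parallel to L and misses F: disjoint embedded annuli H i, which meet F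
   in L only, join L i to L' i.  Such an annulus continues a collar of L in F
   across L, so that the framing is the one induced by F. *)
Definition push_off (n : nat) (L : 'I_n -> R -> S * R) (F : set (S * R))
    (L' : 'I_n -> R -> S * R) : Prop :=
  exists H : 'I_n -> R * R -> S * R,
    [/\ forall i, loop_in [set: S * R] (L' i),
        forall i, {within [set z : R * R | 0 <= z.1 <= 1 /\ 0 <= z.2 <= 1],
          continuous (H i)},
        forall i s, 0 <= s <= 1 -> H i (s, 0) = L i s /\ H i (s, 1) = L' i s,
        forall i t, 0 <= t <= 1 -> H i (0, t) = H i (1, t) &
        (forall i j s s' t t', 0 <= s < 1 -> 0 <= s' < 1 -> 0 <= t <= 1 ->
          0 <= t' <= 1 -> H i (s, t) = H j (s', t') ->
          [/\ i = j, s = s' & t = t']) /\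
        (forall i s t, 0 <= s <= 1 -> 0 < t <= 1 -> ~ F (H i (s, t)))].

(* e is the framing number e(F, L). *)
Definition has_euler (O : set (R * R -> S)) (n : nat) (L : 'I_n -> R -> S * R)
    (F : set (S * R)) (e : int) : Prop :=
  exists l L', [/\ linking_form O l, push_off L F L' &
    e = - l (\sum_i << L i >>) (\sum_i << L' i >>)].

(* A is the matrix of the Gordon-Litherland pairing in some basis of H_1(F). *)
Definition has_GL_matrix (O : set (R * R -> S)) (F : set (S * R)) (r : nat)
    (A : 'M[int]_r) : Prop :=
  exists l d Ft E (b : 'I_r -> {freeg (R -> S * R) / int}),
    [/\ linking_form O l, intersection_form O d, tubular_neighborhood F Ft E,
        H1_basis F b &
        forall i j, A i j =
          l (transfer Ft (fun z => E z 0) (b i)) (b j)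
          - d (push fst (b i)) (push fst (b j))].

Definition mx_signature (r : nat) (A : 'M[int]_r) : int :=
  let D := spectral_diag (map_mx intr A : 'M[algC]_r) in
  #|[pred i | 0 < D 0 i]|%:Z - #|[pred i | D 0 i < 0]|%:Z.

Definition mx_nullity (r : nat) (A : 'M[int]_r) : nat :=
  (r - \rank (map_mx intr A : 'M[rat]_r))%N.

(* The invariants below are computed from auxiliary choices, on which they do
   not depend. *)
Definition link_signature (O : set (R * R -> S)) (n : nat)
    (L : 'I_n -> R -> S * R) (F : set (S * R)) : rat :=
  the 0 [set s | exists r (A : 'M[int]_r) e,
    [/\ has_GL_matrix O F A, has_euler O L F e &
        s = (mx_signature A)%:~R + e%:~R / 2]].

(* The determinant and the nullity depend on the link L only through F. *)
Definition link_det (O : set (R * R -> S)) (F : set (S * R)) : nat :=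
  the 0%N [set m | exists r (A : 'M[int]_r),
    has_GL_matrix O F A /\ m = `|\det A|%N].

(* k is b_0(F). *)
Definition link_nullity (O : set (R * R -> S)) (F : set (S * R)) : nat :=
  the 0%N [set m | exists r (A : 'M[int]_r) k,
    [/\ has_GL_matrix O F A,
        ([set connected_component F x | x in F] #= `I_k)%card &
        m = (mx_nullity A + k - 1)%N]].

Definition vflip (z : S * R) : S * R := (z.1, 1 - z.2).

Definition hflip (f : S -> S) (z : S * R) : S * R := (f z.1, z.2).

End Surfaces.

(* Main.v *)
(* Both mirror images turn a Gordon-Litherland matrix A of F into -A and the
   framing number e into -e.

   Horizontally, linking and intersection numbers both change sign, because
   reflecting a chart turns positive crossings into negative ones.

   Vertically, every crossing of J and K exchanges over and under, so that the
   linking number of their images is J . K - lk(J, K).  The half-fibres give a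
   homotopy from the two lifts of a path to two copies of it, so the transfer
   of a is homologous to 2a in S, and the new pairing of a and b is
   2 a . b - lk(tau a, b) - a . b = a . b - lk(tau a, b).  Similarly L and its
   push-off L' are homotopic in S, so that L . L' = L . L = 0 by antisymmetry,
   and the linking number of L and L' only changes its sign. *)
Require Import Defs.
From HB Require Import structures.
From mathcomp Require Import all_boot all_order all_algebra all_field.
From mathcomp Require Import spectral.
From mathcomp Require Import all_classical all_reals all_analysis.
From mathcomp.multinomials Require Import freeg.
Set Implicit Arguments.
Unset Strict Implicit.
Import Order.TTheory GRing.Theory Num.Theory.
Import numFieldNormedType.Exports.
Local Open Scope classical_set_scope.
Local Open Scope ring_scope.

(** * Free abelian groups and additive extension from generators *)

HB.instance Definition _ (R : nzRingType) (K : choiceType) (M : lmodType R)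
    (f : K -> M) :=
  GRing.isZmodMorphism.Build {freeg K / R} M (fglift f) (lift_is_additive f).

Section Freeg.
Context {K : choiceType}.
Implicit Type c : {freeg K / int}.

Lemma fgliftE {M : lmodType int} (f : K -> M) c :
  fglift f c = \sum_(x <- dom c) coeff x c *: f x.
Proof.
rewrite -{1}(freeg_sumE c) raddf_sum/=.
by apply: eq_bigr => x _; rewrite liftU.
Qed.

Lemma fglift1 {M : lmodType int} (f : K -> M) x : fglift f << x >> = f x.
Proof. by rewrite liftU scale1r. Qed.

Lemma eq_fglift {M : lmodType int} (f g : K -> M) c :
  (forall x, x \in dom c -> f x = g x) -> fglift f c = fglift g c.
Proof.
by move=> fg; rewrite !fgliftE; apply: eq_big_seq => x /fg ->.
Qed.

Lemma fglift_id c : fglift (fun x => << x >>) c = c.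
Proof.
rewrite -[RHS]freeg_sumE fgliftE; apply: eq_bigr => x _.
by rewrite -[X in X *: _]intz scaler_int freegU_mulz intz.
Qed.

Lemma raddf_fglift {M N : lmodType int} (u : {additive M -> N}) (f : K -> M) c :
  u (fglift f c) = fglift (u \o f) c.
Proof.
rewrite !fgliftE raddf_sum; apply: eq_bigr => x _ /=.
by rewrite -[X in X *: _]intz -[X in _ = X *: _]intz !scaler_int raddfMz.
Qed.

(** Reduces a condition on all simplices of an image chain, such as lying in a given set, to a check
    on generators. *)
Lemma dom_fglift {K' : choiceType} (P : K -> Prop) (Q : K' -> Prop)
    (f : K -> {freeg K' / int}) c :
  (forall x, P x -> forall y, y \in dom (f x) -> Q y) ->
  (forall x, x \in dom c -> P x) ->
  forall y, y \in dom (fglift f c) -> Q y.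
Proof.
move=> PQ Pc y; rewrite fgliftE => /dom_sum_subset/flattenP[s /mapP[x]].
by rewrite filter_predT => /Pc Px -> /domZ_subset; exact: PQ.
Qed.

End Freeg.

(** * Signature, nullity and determinant of a negated matrix *)

Section Matrix.
Variable r : nat.
Implicit Type A : 'M[int]_r.

(** Diagonalizing [- A] directly and negating a diagonalization of [A] give two factorizations of
    the characteristic polynomial of [- A] into linear factors, so the roots agree as multisets. The
    order of the eigenvalues is not controlled, hence the permutation. *)
Lemma spectral_diagN (A : 'M[algC]_r) : A \is normalmx ->
  perm_eq [seq spectral_diag (- A) 0 i | i <- enum 'I_r]
          [seq - spectral_diag A 0 i | i <- enum 'I_r].
Proof.
have prodX (d : 'rV[algC]_r) (P : 'M[algC]_r) : P \in unitmx ->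
    char_poly (invmx P *m diag_mx d *m P) = \prod_(i < r) ('X - (d 0 i)%:P).
  move=> Pu.
  have Pp : map_mx polyC P \in unitmx by rewrite map_unitmx.
  rewrite /char_poly /char_poly_mx !map_mxM/= map_invmx.
  rewrite (_ : 'X%:M - _ = invmx (map_mx polyC P) *m
     ('X%:M - map_mx polyC (diag_mx d)) *m map_mx polyC P); last first.
    rewrite mulmxBr mulmxBl; congr (_ - _).
    by rewrite -mulmxA -scalar_mxC mulmxA mulVmx// mul1mx.
  (* Commuting the two determinants brings [P] next to its inverse. *)
  rewrite -mulmxA det_mulmx mulrC -det_mulmx -mulmxA mulmxV// mulmx1.
  rewrite det_trig; last first.
    apply/is_trig_mxP => i j ij; rewrite !mxE -!val_eqE/= lt_eqF//=.
    by rewrite !mulr0n subr0.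
  by apply: eq_bigr => i _; rewrite !mxE eqxx !mulr1n.
move=> An; have NAn : - A \is normalmx.
  move: An => /normalmxP An; apply/normalmxP.
  by rewrite linearN/= map_mxN !mulNmx !mulmxN !opprK.
apply: prod_XsubC_eq; rewrite !big_map.
have := prodX (spectral_diag (- A)) _ (spectral_unit (- A)).
rewrite -(orthomx_spectralP NAn) => EN.
have := prodX (- spectral_diag A) _ (spectral_unit A).
rewrite linearN/= mulmxN mulNmx -(orthomx_spectralP An) EN.
rewrite ![\prod_(i < r) _]big_enum_val/= => ->.
by under eq_bigr do rewrite mxE.
Qed.

(* On a matrix that is not normal, spectral_diag is 0 by convention. *)
Lemma mx_signatureN A : mx_signature (- A) = - mx_signature A.
Proof.
rewrite /mx_signature map_mxN.
set B := map_mx _ A.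
(* Counting along the sequence of diagonal entries makes both cardinals invariant under
   permutation. *)
have cardE (p : pred algC) (D : 'rV[algC]_r) :
    #|[pred i | p (D 0 i)]| = count p [seq D 0 i | i <- enum 'I_r].
  by rewrite count_map cardE -size_filter enumT; congr size; apply: eq_filter.
have [Bn|NBn] := boolP (B \is normalmx).
  have /seq.permP spN := spectral_diagN Bn.
  rewrite (cardE (> 0)) (cardE (< 0)) !spN !count_map opprB.
  rewrite (cardE (> 0)) (cardE (< 0)) !count_map.
  congr (_%:Z - _%:Z); apply: eq_count => i /=.
    by rewrite oppr_gt0.
  by rewrite oppr_lt0.
have NBn' : - B \isn't normalmx.
  apply: contra NBn => /normalmxP; rewrite linearN/= map_mxN !mulNmx !mulmxN.
  by rewrite !opprK => /normalmxP.
have diag0 (C : 'M[algC]_r) : C \isn't normalmx -> spectral_diag C = 0.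
  by rewrite /spectral_diag; case: orthomx_spectral_subproof => // Cn /negP.
rewrite !diag0//.
by rewrite !eq_card0 ?subrr ?oppr0// => i; rewrite !inE mxE ltxx.
Qed.

Lemma mx_nullityN A : mx_nullity (- A) = mx_nullity A.
Proof. by rewrite /mx_nullity map_mxN mxrank_opp. Qed.

Lemma absz_detN A : `|\det (- A)|%N = `|\det A|%N.
Proof. by rewrite -scaleN1r detZ abszM abszX /= exp1n mul1n. Qed.

End Matrix.

(** * Singular chains *)

Section Chains.
Variable R : realType.

HB.instance Definition _ (X Y : topologicalType) (h : X -> Y) :=
  GRing.isZmodMorphism.Build {freeg (R -> X) / int} {freeg (R -> Y) / int}
    (push h) (lift_is_additive _).
HB.instance Definition _ (X : topologicalType) :=
  GRing.isZmodMorphism.Build {freeg (R -> X) / int} {freeg X / int}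
    (@bd1 R X) (lift_is_additive _).
HB.instance Definition _ (X : topologicalType) :=
  GRing.isZmodMorphism.Build {freeg (R * R -> X) / int} {freeg (R -> X) / int}
    (@bd2 R X) (lift_is_additive _).
HB.instance Definition _ (X : topologicalType) (C : set X) (q : X -> X) :=
  GRing.isZmodMorphism.Build {freeg (R -> X) / int} {freeg (R -> X) / int}
    (transfer C q) (lift_is_additive _).

Lemma within_continuous_comp (X Y Z : topologicalType) (A : set X)
    (g : X -> Y) (h : Y -> Z) :
  {within A, continuous g} -> continuous h -> {within A, continuous (h \o g)}.
Proof.
move=> /subspace_continuousP gA ch; apply/subspace_continuousP => x Ax.
by apply: (cvg_comp g h (gA x Ax)); exact: ch.
Qed.

Lemma continuous_comp_within (X Y Z : topologicalType) (A : set Y)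
    (g : X -> Y) (h : Y -> Z) :
  continuous g -> (forall x, A (g x)) -> {within A, continuous h} ->
  continuous (h \o g).
Proof.
move=> cg Ag /subspace_continuousP hA x.
apply: cvg_comp (hA _ (Ag x)) => U /cg.
by apply: (@filterS _ (nbhs x)) => y gU; exact: gU (Ag y).
Qed.

Lemma continuous_pair (X Y Z : topologicalType) (g : X -> Y) (h : X -> Z) :
  continuous g -> continuous h -> continuous (fun x => (g x, h x)).
Proof. by move=> cg ch x; apply: (cvg_pair (cg x) (ch x)). Qed.

Lemma within_comp (X Y Z : topologicalType) (A : set X) (B : set Y)
    (g : X -> Y) (h : Y -> Z) :
  {within A, continuous g} -> (forall x, A x -> B (g x)) ->
  {within B, continuous h} -> {within A, continuous (h \o g)}.
Proof.
move=> /subspace_continuousP gA AB /subspace_continuousP hB.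
apply/subspace_continuousP => x Ax.
apply: cvg_comp (hB _ (AB _ Ax)) => U /(gA x Ax).
by apply: (@filterS _ (nbhs x)) => y gU Ay; exact: gU (AB _ Ay).
Qed.

Lemma continuous_clamp : continuous (@clamp R).
Proof.
move=> x; apply: continuous_max; first exact: cst_continuous.
by apply: continuous_min; [exact: cst_continuous|exact: cvg_id].
Qed.

Lemma clampE (t : R) : 0 <= t <= 1 -> clamp t = t.
Proof.
by move=> /andP[t0 t1]; rewrite /clamp (min_idPr t1) (max_idPr t0).
Qed.

Lemma clamp01 (t : R) : 0 <= clamp t <= 1.
Proof. by rewrite /clamp le_max lexx/= ge_max ler01 ge_min lexx. Qed.

Lemma clampK (t : R) : clamp (clamp t) = clamp t.
Proof. exact/clampE/clamp01. Qed.

Section Push.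
Variables (X Y : topologicalType) (A : set X) (B : set Y) (h : X -> Y).
Hypotheses (ch : continuous h) (AB : forall x, A x -> B (h x)).

Lemma path_in_comp (g : R -> X) : path_in A g -> path_in B (h \o g).
Proof.
case=> cg gc Ag; split.
- by move=> x; apply: continuous_comp; [exact: cg|exact: ch].
- by rewrite -compA gc.
- by move=> t; exact: AB.
Qed.

Lemma bd1_push (c : {freeg (R -> X) / int}) :
  bd1 (push h c) = fglift (fun x => << h x >>) (bd1 c).
Proof.
rewrite /bd1 /push !raddf_fglift; apply: eq_fglift => g _ /=.
by rewrite fglift1 raddfB/= !fglift1.
Qed.

Lemma bd2_push (d : {freeg (R * R -> X) / int}) :
  bd2 (fglift (fun g => << h \o g >>) d) = push h (bd2 d).
Proof.
rewrite /bd2 /push !raddf_fglift; apply: eq_fglift => g _ /=.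
by rewrite fglift1 raddfD raddfB/= !fglift1.
Qed.

Lemma cycle1_push (c : {freeg (R -> X) / int}) :
  cycle1 A c -> cycle1 B (push h c).
Proof.
case=> Ac c0; split; last by rewrite bd1_push c0 raddf0.
apply: dom_fglift Ac => g Ag k; rewrite domU1 inE => /eqP ->.
exact: path_in_comp.
Qed.

Lemma boundary1_push (c : {freeg (R -> X) / int}) :
  boundary1 A c -> boundary1 B (push h c).
Proof.
case=> d [Ad <-]; exists (fglift (fun g => << h \o g >>) d).
split; last exact: bd2_push.
apply: dom_fglift Ad => g [cg Ag] k; rewrite domU1 inE => /eqP ->; split.
  exact: within_continuous_comp.
by move=> z /Ag/AB.
Qed.

End Push.

Lemma push1 (X Y : topologicalType) (h : X -> Y) (g : R -> X) :
  push h << g >> = << h \o g >>.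
Proof. exact: fglift1. Qed.

Lemma push_comp (X Y Z : topologicalType) (h : X -> Y) (k : Y -> Z)
    (c : {freeg (R -> X) / int}) : push k (push h c) = push (k \o h) c.
Proof.
by rewrite /push raddf_fglift; apply: eq_fglift => g _ /=; rewrite fglift1.
Qed.

Lemma push_id (X : topologicalType) (c : {freeg (R -> X) / int}) :
  push id c = c.
Proof. exact: fglift_id. Qed.

Lemma pushK (X Y : topologicalType) (h : X -> Y) (k : Y -> X) :
  cancel h k -> cancel (@push R X Y h) (push k).
Proof.
move=> hK c; rewrite push_comp (_ : k \o h = id) ?push_id//.
by apply/funext => x /=; rewrite hK.
Qed.

Section Groups.
Variables (X : topologicalType) (A : set X).
Implicit Types a b c : {freeg (R -> X) / int}.

Lemma cycle1D a b : cycle1 A a -> cycle1 A b -> cycle1 A (a + b).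
Proof.
case=> Aa a0 [Ab b0]; split; last by rewrite raddfD/= a0 b0 addr0.
by move=> g /domD_subset; rewrite mem_cat => /orP[/Aa|/Ab].
Qed.

Lemma cycle1_0 : cycle1 A (0 : {freeg (R -> X) / int}).
Proof. by split; [move=> g; rewrite dom0|rewrite raddf0]. Qed.

Lemma cycle1_sum (I : Type) (s : seq I) (F : I -> {freeg (R -> X) / int}) :
  (forall i, cycle1 A (F i)) -> cycle1 A (\sum_(i <- s) F i).
Proof.
by move=> AF; elim/big_ind: _ => //; [exact: cycle1_0|exact: cycle1D].
Qed.

Lemma cycle1_loop (g : R -> X) : loop_in A g -> cycle1 A << g >>.
Proof.
move=> [Ag g01]; split; first by move=> k; rewrite domU1 inE => /eqP ->.
by rewrite /bd1 fglift1 g01 subrr.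
Qed.

Lemma boundary1D a b : boundary1 A a -> boundary1 A b -> boundary1 A (a + b).
Proof.
case=> d [Ad <-] [e [Ae <-]]; exists (d + e); rewrite raddfD; split => // g.
by move=> /domD_subset; rewrite mem_cat => /orP[/Ad|/Ae].
Qed.

Lemma boundary1N a : boundary1 A a -> boundary1 A (- a).
Proof.
case=> d [Ad <-]; exists (- d); rewrite raddfN; split => // g.
by rewrite domN; exact: Ad.
Qed.

Lemma boundary1_0 : boundary1 A (0 : {freeg (R -> X) / int}).
Proof. by exists 0; rewrite raddf0; split => // g; rewrite dom0. Qed.

Lemma boundary1_sum (I : Type) (s : seq I) (P : pred I)
    (F : I -> {freeg (R -> X) / int}) :
  (forall i, P i -> boundary1 A (F i)) ->
  boundary1 A (\sum_(i <- s | P i) F i).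
Proof.
by move=> AF; elim/big_ind: _ => //; [exact: boundary1_0|exact: boundary1D].
Qed.

Lemma boundary1Z a (k : int) : boundary1 A a -> boundary1 A (k *: a).
Proof.
case=> d [Ad <-]; exists (k *: d); split.
  by move=> g /domZ_subset/Ad.
by rewrite -[k]intz !scaler_int raddfMz.
Qed.

(** The identity that the boundary of a boundary vanishes. Pairings are additive on cycles only, so
    a boundary must be known to be a cycle before it can be split off an argument. *)
Lemma boundary1_cycle a : boundary1 A a -> cycle1 A a.
Proof.
case=> d [Ad <-]; split; last first.
  rewrite /bd1 /bd2 raddf_fglift fgliftE big1// => g _ /=.
  rewrite raddfD raddfB/= !fglift1.
  rewrite (clampE (t := 0)) ?lexx ?ler01// (clampE (t := 1)) ?lexx ?ler01//.
  have triv (V : zmodType) (x y z : V) : x - y - (x - z) + (y - z) = 0.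
    by rewrite opprB [x - y + _]addrC !addrA !subrK subrr.
  by rewrite triv scaler0.
apply: dom_fglift Ad => g [cg Ag] k.
(* The three faces are the cases [(id, 1)], [(id, id)] and [(0, id)] of [(u, v)]. *)
have face (u v : R -> R) : continuous u -> continuous v ->
    (forall t, 0 <= u (clamp t) <= v (clamp t) /\ v (clamp t) <= 1) ->
    path_in A (fun t => g (u (clamp t), v (clamp t))).
  move=> cu cv uv; split; last by move=> t; apply/Ag/uv.
    apply: (@continuous_comp_within _ _ _ (@triangle R)
      (fun t => (u (clamp t), v (clamp t))) g) => //.
    apply: continuous_pair => x.
      by apply: continuous_comp; [exact: continuous_clamp|exact: cu].
    by apply: continuous_comp; [exact: continuous_clamp|exact: cv].
  by apply/funext => t /=; rewrite clampK.
move=> /domD_subset; rewrite mem_cat => /orP[/domB|].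
  rewrite mem_cat !domU1 !inE => /orP[]/eqP ->.
    apply: (face id (cst 1)).
    - by move=> t; exact: cvg_id.
    - exact: cst_continuous.
    - by move=> t; rewrite lexx clamp01.
  apply: (face id id); try by move=> t; exact: cvg_id.
  by move=> t; rewrite lexx andbT; have /andP[] := clamp01 t.
rewrite domU1 inE => /eqP ->; apply: (face (cst 0) id).
- exact: cst_continuous.
- by move=> t; exact: cvg_id.
- by move=> t; rewrite lexx; have /andP[] := clamp01 t.
Qed.

End Groups.
End Chains.

(** * Path lifting in double covers *)

Section DoubleCover.
Variables (R : realType) (X : topologicalType).
Implicit Types (F C : set X) (q : X -> X) (g h : R -> X).

(** The part of [tubular_neighborhood] on which path lifting relies, with [q z] in the role of
    [E z 0]. *)
Definition double_cover F C q : Prop :=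
  (forall z, C z -> F (q z)) /\
  forall x, F x -> exists U : set X, exists sp sm : X -> X,
    [/\ open U /\ U x,
        {within F `&` U, continuous sp} /\ {within F `&` U, continuous sm},
        forall y, F y -> U y ->
          [/\ C (sp y), C (sm y), q (sp y) = y & q (sm y) = y] /\
          sp y <> sm y &
        forall z, C z -> U (q z) -> z = sp (q z) \/ z = sm (q z)].

Definition fibre C q y := [set z | C z /\ q z = y].

Definition lifts C q g := [set h | path_in C h /\ q \o h = g].

(** Unlike [lifts], this does not ask [h] to be constant outside [0,1], so it also describes lifts
    over the other intervals met during the construction. *)
Definition lift_of C q g h : Prop :=
  [/\ continuous h, forall t, C (h t) & forall t, q (h t) = g t].

Variables (F C : set X) (q : X -> X).
Hypotheses (hX : hausdorff_space X) (cover : double_cover F C q).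

Lemma fibre_pair y : F y ->
  exists z w, z <> w /\ fibre C q y = [set z; w].
Proof.
move=> Fy; have [U [sp [sm [[_ Uy] _ secs fib]]]] := cover.2 y Fy.
have [[Cp Cm qp qm] spm] := secs y Fy Uy.
exists (sp y), (sm y); split => //; apply/seteqP; split => [z [Cz qz]|z].
  by have := fib z Cz; rewrite qz => /(_ Uy).
by move=> /= [] ->.
Qed.

(** Disjoint neighborhoods separate the values of [s1] and [s2] at [g t]. Near [t], [h] stays in the
    first and [s2 \o g] in the second, so [h] cannot jump to the other section. *)
Lemma lift_section g h (U : set X) (s1 s2 : X -> X) t :
  continuous g -> lift_of C q g h -> (forall u, F (g u)) ->
  open U -> U (g t) ->
  {within F `&` U, continuous s1} -> {within F `&` U, continuous s2} ->
  s1 (g t) <> s2 (g t) ->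
  (forall z, C z -> U (q z) -> z = s1 (q z) \/ z = s2 (q z)) ->
  h t = s1 (g t) ->
  \forall u \near t, h u = s1 (g u).
Proof.
move=> cg [ch Ch qh] Fg Uo Ut c1 c2 s12 fib ht.
have cs (s : X -> X) : {within F `&` U, continuous s} -> {for t, continuous (s \o g)}.
  move=> /subspace_continuousP cs.
  apply: cvg_comp (cs (g t) (conj (Fg t) Ut)) => V /(cg t) gV.
  have gU := cg t _ (open_nbhs_nbhs (conj Uo Ut)).
  by apply: (@filterS2 _ (nbhs t) _ _ _ _ _ gU gV) => u Uu; apply; split.
have [[V1 V2] /= [V1t V2t] [V1o V2o V12]] :
    exists2 AB, (s1 (g t) \in AB.1 /\ s2 (g t) \in AB.2) &
      [/\ open AB.1, open AB.2 & AB.1 `&` AB.2 == set0].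
  by move: hX; rewrite open_hausdorff; apply; apply/eqP.
have hV : \forall u \near t, V1 (h u).
  by apply: ch; apply: open_nbhs_nbhs; split=> //; rewrite ht -inE.
have sV : \forall u \near t, V2 (s2 (g u)).
  by apply: (cs s2 c2); apply: open_nbhs_nbhs; split=> //; rewrite -inE.
have gU : \forall u \near t, U (g u).
  exact: cg t _ (open_nbhs_nbhs (conj Uo Ut)).
near=> u.
have gUu : U (g u) by near: u.
have := fib (h u) (Ch u); rewrite qh => /(_ gUu)[//|E].
have : (V1 `&` V2) (h u) by split; [near: u|rewrite E; near: u].
by rewrite (eqP V12).
Unshelve. all: by end_near. Qed.

(** The set where two lifts agree is open and closed in the connected line. *)
Lemma lift_unique g h h' t0 : continuous g -> (forall u, F (g u)) ->
  lift_of C q g h -> lift_of C q g h' -> h t0 = h' t0 -> h = h'.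
Proof.
move=> cg Fg lh lh' hh'.
(* Here [s1] is the section through [k t]; it may be either of the two. A lift that differs from [k]
   at [t] follows [s2] nearby, whose values are distinct from those of [s1]. *)
have key (k k' : R -> X) t (U : set X) (s1 s2 : X -> X) :
   lift_of C q g k -> lift_of C q g k' -> open U -> U (g t) ->
   {within F `&` U, continuous s1} -> {within F `&` U, continuous s2} ->
   (forall y, F y -> U y -> s1 y <> s2 y) ->
   (forall z, C z -> U (q z) -> z = s1 (q z) \/ z = s2 (q z)) ->
   k t = s1 (g t) ->
   (k t = k' t -> \forall u \near t, k u = k' u) /\
   (k t <> k' t -> \forall u \near t, k u <> k' u).
  move=> lk lk' Uo Ut c1 c2 s12 fib kt.
  have fib' z : C z -> U (q z) -> z = s2 (q z) \/ z = s1 (q z).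
    by move=> Cz Uz; have [] := fib z Cz Uz; [right|left].
  have nk := lift_section cg lk Fg Uo Ut c1 c2 (s12 _ (Fg t) Ut) fib kt.
  split=> kk'.
    have k't : k' t = s1 (g t) by rewrite -kk'.
    have nk' := lift_section cg lk' Fg Uo Ut c1 c2 (s12 _ (Fg t) Ut) fib k't.
    by near=> u; rewrite (near nk u)// (near nk' u).
  have [_ Ck' qk'] := lk'.
  have k't : k' t = s2 (g t).
    have := fib (k' t) (Ck' t); rewrite qk' => /(_ Ut)[E|//].
    by case: kk'; rewrite kt E.
  have s21 : s2 (g t) <> s1 (g t) by exact/nesym/(s12 _ (Fg t) Ut).
  have nk' := lift_section cg lk' Fg Uo Ut c2 c1 s21 fib' k't.
  have gU : \forall u \near t, U (g u).
    exact: cg t _ (open_nbhs_nbhs (conj Uo Ut)).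
  near=> u; rewrite (near nk u)// (near nk' u)//; apply: s12 => //.
  by near: u.
have loc t : (h t = h' t -> \forall u \near t, h u = h' u) /\
             (h t <> h' t -> \forall u \near t, h u <> h' u).
  have [U [sp [sm [[Uo Ut] [cp cm] secs fib]]]] := cover.2 (g t) (Fg t).
  have [_ Ch qh] := lh.
  have := fib (h t) (Ch t); rewrite qh => /(_ Ut)[ht|ht].
    by apply: (key h h' t U sp sm) => // y Fy Uy; have [] := secs y Fy Uy.
  apply: (key h h' t U sm sp) => // [y Fy Uy|z Cz Uz].
    by apply: nesym; have [] := secs y Fy Uy.
  by have [] := fib z Cz Uz; [right|left].
have oE : open [set t | h t = h' t].
  by rewrite openE => t /(loc t).1.
have cE : closed [set t | h t = h' t].
  by rewrite -openC openE => t /(loc t).2.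
have RT : connected [set: R] by apply/connected_intervalP.
have ET : [set t | h t = h' t] = setT.
  apply: RT; first by exists t0.
    by exists [set t | h t = h' t] => //; rewrite setTI.
  by exists [set t | h t = h' t] => //; rewrite setTI.
by apply/funext => t; have : [set t | h t = h' t] t by rewrite ET.
Unshelve. all: by end_near. Qed.

(** Extending the restriction of a path to [a,b] by constants keeps all partial paths and their
    lifts defined on the whole line. *)
Let clip (a b t : R) : R := Num.max a (Num.min b t).

Let liftable g a b := forall z, C z -> q z = g a ->
  exists h, [/\ lift_of C q (g \o clip a b) h & h a = z].

Lemma clip_continuous a b : continuous (clip a b).
Proof.
move=> x; apply: continuous_max; first exact: cst_continuous.
by apply: continuous_min; [exact: cst_continuous|exact: cvg_id].
Qed.

Lemma clip_itv (a b t : R) : a <= b -> a <= clip a b t <= b.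
Proof. by move=> ab; rewrite /clip le_max lexx/= ge_max ab ge_min lexx. Qed.

(** The lift over the second interval is started at the endpoint [h1 b] of the first lift, so that
    the two pieces glue. *)
Lemma liftable_trans g a b c : a <= b -> b <= c ->
  liftable g a b -> liftable g b c -> liftable g a c.
Proof.
move=> ab bc gab gbc z Cz qz.
have [h1 [[ch1 Ch1 qh1] h1a]] := gab z Cz qz.
have h1b : q (h1 b) = g b.
  by rewrite qh1 /= /clip minxx (max_idPr ab).
have [h2 [[ch2 Ch2 qh2] h2b]] := gbc (h1 b) (Ch1 b) h1b.
exists (fun t => if t <= b then h1 t else h2 t); split; last by rewrite ab.
split=> [t|t|t]; last 2 first.
- by case: ifP.
- case: ifPn => [tb|]; first rewrite qh1 /= /clip.
    by rewrite (min_idPr tb) (min_idPr (le_trans tb bc)).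
  rewrite -ltNge qh2 /= /clip => bt.
  have bm : b <= Num.min c t by rewrite le_min bc ltW.
  by rewrite (max_idPr bm) (max_idPr (le_trans ab bm)).
have [tb|[bt|tb]] : t < b \/ (b < t \/ t = b).
  by case: (ltgtP t b) => E; [left|right; left|right; right].
- rewrite /continuous_at /= (ltW tb); apply: cvg_trans (ch1 t).
  apply: near_eq_cvg; near=> u; rewrite ifT//.
  by apply: ltW; near: u; exact: lt_nbhsl.
- have tb : (t <= b) = false by rewrite leNgt bt.
  rewrite /continuous_at /= tb; apply: cvg_trans (ch2 t).
  apply: near_eq_cvg; near=> u; rewrite leNgt ifN// negbK.
  by near: u; exact: lt_nbhsr.
(* At the junction both pieces tend to the common value [h1 b]. *)
- rewrite tb /continuous_at /= lexx => V hV.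
  have n1 := ch1 b V hV; have n2 := ch2 b V; rewrite h2b in n2.
  by apply: (@filterS2 _ (nbhs b) _ _ _ _ _ n1 (n2 hV)) => u /=; case: ifP.
Unshelve. all: by end_near. Qed.

(** A short interval around [t] is mapped into one trivializing open set, where composing [g] with
    the section through the given starting point is a lift. *)
Lemma liftable_local g t : continuous g -> (forall u, F (g u)) ->
  \forall e \near 0^'+, forall a b, t - e < a -> a <= b -> b < t + e ->
    liftable g a b.
Proof.
move=> cg Fg.
have [U [sp [sm [[Uo Ut] [cp cm] secs fib]]]] := cover.2 (g t) (Fg t).
have /nbhs_ballP[e /= e0 eU] := cg t _ (open_nbhs_nbhs (conj Uo Ut)).
near=> d => a b ta ab bt z Cz qz.
have gU u : U (g (clip a b u)).
  apply: eU; rewrite /ball/= ltr_distlC.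
  have /andP[au ub] := clip_itv u ab.
  have de : d < e by near: d; exact: nbhs_right_lt.
  apply/andP; split.
    by rewrite (lt_le_trans _ au)// (le_lt_trans _ ta)// lerD2l lerN2 ltW.
  by rewrite (le_lt_trans ub)// (lt_le_trans bt)// lerD2l ltW.
have ga : clip a b a = a by rewrite /clip (min_idPr ab) maxxx.
have mk (s : X -> X) : {within F `&` U, continuous s} ->
    (forall y, F y -> U y -> C (s y) /\ q (s y) = y) -> z = s (q z) ->
    exists h, [/\ lift_of C q (g \o clip a b) h & h a = z].
  move=> cs sec zs; exists (s \o (g \o clip a b)).
  split; last by rewrite /= ga -qz.
  split=> [|u|u]; last 2 first.
  - by have [] := sec _ (Fg _) (gU u).
  - by have [] := sec _ (Fg _) (gU u).
  apply: (continuous_comp_within (A := F `&` U)) => //; last first.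
    by move=> u; split; [exact: Fg|exact: gU].
  by move=> u; apply: continuous_comp; [exact: clip_continuous|exact: cg].
have := fib z Cz; rewrite qz -ga => /(_ (gU a)); rewrite ga -qz => -[].
  by apply: mk => // y Fy Uy; have [[]] := secs y Fy Uy.
by apply: mk => // y Fy Uy; have [[]] := secs y Fy Uy.
Unshelve. all: by end_near. Qed.

(** The endpoints up to which [g] can be lifted from 0 have a supremum; local lifting there goes
    past it unless 1 has been reached. *)
Lemma liftable01 g : continuous g -> (forall u, F (g u)) -> liftable g 0 1.
Proof.
move=> cg Fg.
pose W := [set b : R | 0 <= b <= 1 /\ liftable g 0 b].
have loc t : exists2 e, 0 < e & forall a b, t - e < a -> a <= b -> b < t + e ->
    liftable g a b.
  near (0 : R)^'+ => e; exists e; first by near: e; exact: nbhs_right_gt.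
  by near: e; exact: liftable_local.
have W0 : W 0.
  split; first by rewrite lexx ler01.
  have [e e0 le] := loc 0; apply: le => //.
    by rewrite sub0r oppr_lt0.
  by rewrite add0r.
have supW : has_sup W.
  by split; [exists 0|exists 1 => b [/andP[]]].
have s0 : 0 <= sup W by apply: ub_le_sup => //; exact: supW.2.
have s1 : sup W <= 1 by apply: ge_sup => [|b [/andP[]]//]; exists 0.
have [e e0 le] := loc (sup W).
have [b [/andP[b0 b1] gb] sb] := sup_adherent e0 supW.
(* Half the local radius beyond the supremum, cut off at 1. *)
pose b' := Num.min 1 (sup W + e / 2).
have bs : b <= sup W by apply: ub_le_sup; [exact: supW.2|split=> //; rewrite b0].
have e2 : 0 < e / 2 by rewrite divr_gt0.
have bb' : b <= b' by rewrite le_min b1 (le_trans bs)// lerDl ltW.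
have Wb' : W b'.
  split; first by rewrite (le_trans b0 bb')/= ge_min lexx.
  apply: (liftable_trans b0 bb' gb); apply: le => //.
  by rewrite gt_min ltrD2l ltr_pdivrMr// ltr_pMr// ltr1n orbT.
(* As [sup W + e / 2] exceeds [sup W], this forces [1 <= sup W]; hence [b'] is 1 and [Wb'] contains
   the claim. *)
have : b' <= sup W by apply: ub_le_sup => //; exact: supW.2.
rewrite /b' ge_min gerDl [X in _ || X]leNgt e2 orbF => s1'.
by move: Wb'; rewrite /W/= /b' min_l => [[]//|]; rewrite (le_trans s1')// lerDl ltW.
Unshelve. all: by end_near. Qed.

Lemma lift_exists g z : path_in F g -> C z -> q z = g 0 ->
  exists2 h, lifts C q g h & h 0 = z.
Proof.
move=> [cg gc Fg] Cz qz.
have gcE u : g (clamp u) = g u by exact: (congr1 (fun k => k u) gc).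
have [h [lh h0]] := liftable01 cg Fg Cz qz; exists h => //.
have {}lh : lift_of C q g h.
  by case: lh => ch Ch qh; split=> // t; rewrite qh; exact: gcE.
have [ch Ch qh] := lh.
split; last by apply/funext.
(* [h \o clamp] also lifts [g] and agrees with [h] at 0, so the two are equal. *)
split=> //; apply: (lift_unique (t0 := 0) cg Fg _ lh).
  split=> [t|t|t] /=; last 2 first.
  - exact: Ch.
  - by rewrite qh; exact: gcE.
  by apply: continuous_comp; [exact: continuous_clamp|exact: ch].
by rewrite /= clampE// lexx ler01.
Qed.

Lemma lifts_eq g h h' t : path_in F g -> lifts C q g h -> lifts C q g h' ->
  h t = h' t -> h = h'.
Proof.
move=> [cg _ Fg] [[ch _ Ch] qh] [[ch' _ Ch'] qh'].
apply: lift_unique Fg _ _ => //; split=> // u.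
  exact: (congr1 (fun k => k u) qh).
exact: (congr1 (fun k => k u) qh').
Qed.

Lemma lifts_pair g : path_in F g -> exists h1 h2,
  [/\ h1 <> h2, lifts C q g = [set h1; h2],
      h1 0 <> h2 0 /\ fibre C q (g 0) = [set h1 0; h2 0] &
      h1 1 <> h2 1 /\ fibre C q (g 1) = [set h1 1; h2 1]].
Proof.
move=> Fg; have [_ _ FgT] := Fg.
have [z [w [zw fib0]]] := fibre_pair (FgT 0).
have [Cz qz] : fibre C q (g 0) z by rewrite fib0; left.
have [Cw qw] : fibre C q (g 0) w by rewrite fib0; right.
have [h1 l1 h10] := lift_exists Fg Cz qz.
have [h2 l2 h20] := lift_exists Fg Cw qw.
have h12 t : h1 t <> h2 t.
  by move/(lifts_eq Fg l1 l2) => E; apply: zw; rewrite -h10 -h20 E.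
have lfib h t : lifts C q g h -> fibre C q (g t) (h t).
  by move=> [[_ _ Ch] <-]; split.
exists h1, h2; split.
- by move=> E; apply: (h12 0); rewrite E.
- apply/seteqP; split=> [h lh|h [] ->//].
  have := lfib h 0 lh; rewrite fib0 => -[h0|h0].
    by left; apply: (lifts_eq (t := 0) Fg lh l1); rewrite h0.
  by right; apply: (lifts_eq (t := 0) Fg lh l2); rewrite h0.
- by split=> //; rewrite h10 h20.
split=> //; have [z' [w' [zw' fib1]]] := fibre_pair (FgT 1).
have := lfib h1 1 l1; have := lfib h2 1 l2; have := h12 1.
rewrite fib1 => n [] E2 [] E1; rewrite ?E1 ?E2 in n *; rewrite // setUC //.
Qed.

End DoubleCover.

(** * The transfer in homology *)

Section Homotopy.
Variables (R : realType) (Y : topologicalType).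

Definition unit_square : set (R * R) := [set z | 0 <= z.1 <= 1 /\ 0 <= z.2 <= 1].

(* The diagonal cuts the square into two singular simplices. *)
Lemma boundary1_square (K : R * R -> Y) :
  {within unit_square, continuous K} ->
  boundary1 [set: Y]
    (<< (fun s => K (clamp s, 0)) >> + << (fun t => K (1, clamp t)) >>
     - << (fun t => K (0, clamp t)) >> - << (fun s => K (clamp s, 1)) >>).
Proof.
move=> cK; pose swap (z : R * R) := (z.2, z.1).
have tri (z : R * R) : triangle z -> unit_square z /\ unit_square (swap z).
  case=> /andP[z0 z12] z1; rewrite /unit_square/= z0 z1 (le_trans z0 z12).
  by rewrite (le_trans z12 z1).
(* [swap] carries the standard triangle to the half of the square below the diagonal; the common
   diagonal face cancels in the difference. *)
exists (<< K \o swap >> - << K >>); split; last first.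
  rewrite raddfB/= /bd2 !fglift1/= opprD opprB.
  have triv (V : zmodType) (a b c d e : V) :
      a - e + b + (e - d - c) = b + a - c - d.
    by rewrite !addrA [LHS](ACl (3*1*6*5*(4*2)))/= subrr addr0.
  exact: triv.
move=> g /domB; rewrite mem_cat !domU1 !inE => /orP[]/eqP ->; split => //.
  apply: within_comp cK; last by move=> z /tri[].
  apply: continuous_subspaceT.
  by apply: continuous_pair => z; [exact: cvg_snd|exact: cvg_fst].
apply: (within_comp (g := id)) cK; last by move=> z /tri[].
by apply: continuous_subspaceT => z; exact: cvg_id.
Qed.

End Homotopy.

Lemma raddf_fsbig (I : choiceType) (M N : zmodType) (u : {additive M -> N})
    (A : set I) (F : I -> M) : finite_set A ->
  u (\sum_(i \in A) F i) = \sum_(i \in A) u (F i).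
Proof. by move=> fA; rewrite !fsbig_finite// raddf_sum. Qed.

Lemma fsbig_pair (I : choiceType) (M : zmodType) (a b : I) (F : I -> M) :
  a <> b -> \sum_(i \in [set a; b]) F i = F a + F b.
Proof.
move=> ab; rewrite fsbigU0/= ?fsbig_set1//; try exact: finite_set1.
by move=> i [-> /ab].
Qed.

Section Transfer.
Variables (R : realType) (S Y : topologicalType).
Hypothesis hS : hausdorff_space S.
Variables (F Ft : set (S * R)) (E : S * R -> R -> S * R) (p : S * R -> Y).
Hypotheses (tub : tubular_neighborhood F Ft E) (cp : continuous p).

Let q z := E z 0.

Lemma hausdorff_thick : hausdorff_space (S * R)%type.
Proof.
move=> [x1 x2] [y1 y2] clxy; congr (_, _).
  apply: hS => A B nA nB.
  have [||z [Az Bz]] := clxy (fst @^-1` A) (fst @^-1` B).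
  - exact: cvg_fst nA.
  - exact: cvg_fst nB.
  by exists z.1.
apply: (@Rhausdorff R) => A B nA nB.
have [||z [Az Bz]] := clxy (snd @^-1` A) (snd @^-1` B).
- exact: cvg_snd nA.
- exact: cvg_snd nB.
by exists z.2.
Qed.

Lemma tubular_double_cover : double_cover F Ft q.
Proof. by case: tub => _ _ Ft1 _ sec; split=> // z /Ft1[]. Qed.

Let track z : {freeg (R -> Y) / int} := << (fun t => p (E z (clamp t))) >>.

(** Moving along the half-fibres sweeps out a square from [p \o g] to [p \o h]; its other two sides
    are the half-fibres at the ends of [h]. *)
Lemma lift_boundary g h : lifts Ft q g h ->
  boundary1 [set: Y] (<< p \o g >> + track (h 1) - track (h 0) - << p \o h >>).
Proof.
move=> [[ch hc Fth] qh]; have [_ cE Ft1 _ _] := tub.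
pose K (z : R * R) := p (E (h z.1) z.2).
have cK : {within @unit_square R, continuous K}.
  apply: (@within_continuous_comp _ _ _ _ (fun z => E (h z.1) z.2)) => //.
  apply: (@within_comp _ _ _ _ [set w : (S * R) * R | Ft w.1 /\ 0 <= w.2 <= 1]
    (fun z : R * R => (h z.1, z.2)) (fun w => E w.1 w.2)) => //.
  - apply: continuous_subspaceT; apply: continuous_pair => z; last exact: cvg_snd.
    by apply: continuous_comp; [exact: cvg_fst|exact: ch].
  - by move=> z [_ z2]; split; first exact: Fth.
have hcE t : h (clamp t) = h t by exact: (congr1 (fun k => k t) hc).
have := boundary1_square cK; rewrite /K/=.
rewrite (_ : (fun s => p (E (h (clamp s)) 0)) = p \o g); last first.
  by apply/funext => s; rewrite hcE -qh.
rewrite (_ : (fun s => p (E (h (clamp s)) 1)) = p \o h) //.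
by apply/funext => s; rewrite hcE/= (Ft1 _ (Fth s)).1.
Qed.

(** Adding the squares of both lifts of a path [g] compares twice [g] with its lifts, up to a term
    at each end which depends only on the endpoint of [g]. Over a cycle these terms cancel. *)
Lemma transfer_homologous (c : {freeg (R -> S * R) / int}) : cycle1 F c ->
  boundary1 [set: Y] (push p (transfer Ft q c) - push p c *+ 2).
Proof.
move=> [Fc c0].
have hX := hausdorff_thick.
have cov := tubular_double_cover.
pose fib y : {freeg (R -> Y) / int} := \sum_(z \in fibre Ft q y) track z.
pose D g : {freeg (R -> Y) / int} :=
  << p \o g >> *+ 2 + (fib (g 1) - fib (g 0))
  - push p (\sum_(h \in lifts Ft q g) (<< h >> : {freeg (R -> S * R) / int})).
have DB g : path_in F g -> boundary1 [set: Y] (D g).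
  move=> Fg; have [h1 [h2 [h12 lg [n0 f0] [n1 f1]]]] := lifts_pair hX cov Fg.
  rewrite /D /fib f0 f1 lg !fsbig_pair// (raddfD (push p))/= !push1.
  have l1 : lifts Ft q g h1 by rewrite lg; left.
  have l2 : lifts Ft q g h2 by rewrite lg; right.
  have := boundary1D (lift_boundary l1) (lift_boundary l2).
  congr boundary1.
  have triv (V : zmodType) (a b u d e v i : V) :
    a + b - u - d + (a + e - v - i) = a *+ 2 + (b + e - (u + v)) - (d + i).
    by rewrite mulr2n !opprD !addrA [LHS](ACl (1*5*2*6*3*7*4*8)).
  exact: triv.
have DE : fglift D c = push p c *+ 2 - push p (transfer Ft q c).
  (* The endpoint terms of all paths add up to [fglift fib (bd1 c)], inserted here as a zero. *)
  rewrite -[RHS]addr0 -[X in _ = _ + X](raddf0 (fglift fib)) -c0.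
  rewrite /bd1 /transfer (raddf_fglift (push p)) (raddf_fglift (fglift fib)).
  rewrite [push p c]/push !fgliftE.
  rewrite -sumrMnl -sumrB -big_split/=; apply: eq_bigr => g _.
  rewrite (raddfB (fglift fib))/= !fglift1 scalerMnr -scalerBr -scalerDr.
  by rewrite addrAC.
rewrite -opprB -DE; apply: boundary1N; rewrite fgliftE big_seq.
by apply: boundary1_sum => g /Fc Fg; exact/boundary1Z/DB.
Qed.

End Transfer.

(** * Transport along homeomorphisms *)

Section Pairing.
Variable R : realType.

Section Hom.
Variables (X : topologicalType) (A B : set X).
Variable l : {freeg (R -> X) / int} -> {freeg (R -> X) / int} -> int.
Hypothesis lP : H1_pairing A B l.

Lemma pairing_homl a a' b : cycle1 A a' -> cycle1 B b ->
  boundary1 A (a - a') -> l a b = l a' b.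
Proof.
case: lP => lD _ l0 _ Aa' Bb ab.
have Aab := boundary1_cycle ab.
by rewrite -[a in LHS](subrK a') lD// l0// add0r.
Qed.

Lemma pairing_homr a b b' : cycle1 A a -> cycle1 B b' ->
  boundary1 B (b - b') -> l a b = l a b'.
Proof.
case: lP => _ lD _ l0 Aa Bb' bb.
have Bbb := boundary1_cycle bb.
by rewrite -[b in LHS](subrK b') lD// l0// add0r.
Qed.

Lemma pairing_opp : H1_pairing A B (fun a b => - l a b).
Proof.
case: lP => lDl lDr l0l l0r; split.
- by move=> a a' b ? ? ?; rewrite lDl// opprD.
- by move=> a b b' ? ? ?; rewrite lDr// opprD.
- by move=> a b ? ?; rewrite l0l// oppr0.
- by move=> a b ? ?; rewrite l0r// oppr0.
Qed.

Lemma pairing_add l' : H1_pairing A B l' ->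
  H1_pairing A B (fun a b => l' a b + l a b).
Proof.
case: lP => lDl lDr l0l l0r [lDl' lDr' l0l' l0r']; split.
- by move=> a a' b ? ? ?; rewrite lDl// lDl'// addrACA.
- by move=> a b b' ? ? ?; rewrite lDr// lDr'// addrACA.
- by move=> a b ? ?; rewrite l0l// l0l'// addr0.
- by move=> a b ? ?; rewrite l0r// l0r'// addr0.
Qed.

End Hom.

Lemma pairing_push (X Y : topologicalType) (A B : set X) (A' B' : set Y)
    (h : X -> Y) l :
  continuous h -> (forall x, A x -> A' (h x)) -> (forall x, B x -> B' (h x)) ->
  @H1_pairing R Y A' B' l ->
  H1_pairing A B (fun a b => l (push h a) (push h b)).
Proof.
move=> ch AA BB [lDl lDr l0l l0r].
have cA a : cycle1 A a -> cycle1 A' (push h a) by exact: cycle1_push.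
have cB a : cycle1 B a -> cycle1 B' (push h a) by exact: cycle1_push.
have dA a : boundary1 A a -> boundary1 A' (push h a) by exact: boundary1_push.
have dB a : boundary1 B a -> boundary1 B' (push h a) by exact: boundary1_push.
split.
- by move=> a a' b /cA ? /cA ? /cB ?; rewrite raddfD/= lDl.
- by move=> a b b' /cA ? /cB ? /cB ?; rewrite raddfD/= lDr.
- by move=> a b /dA ? /cB ?; exact: l0l.
- by move=> a b /cA ? /dB ?; exact: l0r.
Qed.

End Pairing.

Section Transport.
Variables (R : realType) (S : topologicalType).
Variables (f g : S * R -> S * R).
Hypotheses (cf : continuous f) (cg : continuous g).
Hypotheses (fK : cancel f g) (gK : cancel g f).

(** Mirror images of sets are handled as preimages under the inverse, where membership is a mere
    unfolding. *)
Lemma image_homeo (A : set (S * R)) : f @` A = g @^-1` A.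
Proof.
apply/seteqP; split=> [_ [x Ax <-]|x Ax]; first by rewrite /= fK.
by exists (g x).
Qed.

Lemma H1_basis_homeo (F : set (S * R)) (r : nat)
    (b : 'I_r -> {freeg (R -> S * R) / int}) :
  H1_basis F b -> H1_basis (g @^-1` F) (fun i => push f (b i)).
Proof.
move=> [Fb bas].
have fF x : F x -> (g @^-1` F) (f x) by rewrite /= fK.
have gF x : (g @^-1` F) x -> F (g x) by [].
split=> [i|z zc]; first exact: cycle1_push fF _ (Fb i).
(* The coordinates of [z] are those of its pull-back in the original basis. *)
have [m [mz mu]] := bas _ (cycle1_push cg gF zc).
have E (k : {ffun 'I_r -> int}) :
    push g (z - \sum_i push f (b i) *~ k i) = push g z - \sum_i b i *~ k i.
  rewrite raddfB raddf_sum/=; congr (_ - _); apply: eq_bigr => i _.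
  by rewrite raddfMz/= (pushK fK).
exists m; split=> [|k kz].
  rewrite -(pushK gK (_ - _)) E; exact: boundary1_push cf fF _ mz.
by apply: mu; rewrite -E; exact: boundary1_push cg gF _ kz.
Qed.

Lemma tubular_homeo (F Ft : set (S * R)) (E : S * R -> R -> S * R) :
  tubular_neighborhood F Ft E ->
  tubular_neighborhood (g @^-1` F) (g @^-1` Ft) (fun z t => f (E (g z) t)).
Proof.
move=> [kFt cE E1 Einj cover]; split.
- rewrite -image_homeo; apply: continuous_compact kFt.
  exact: continuous_subspaceT.
- apply: (@within_continuous_comp _ _ _ _
    (fun w : S * R * R => E (g w.1) w.2)) => //.
  apply: (@within_comp _ _ _ _ [set w : S * R * R | Ft w.1 /\ 0 <= w.2 <= 1]
    (fun w : S * R * R => (g w.1, w.2)) (fun w => E w.1 w.2)) => //.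
  apply: continuous_subspaceT; apply: continuous_pair => z; last exact: cvg_snd.
  by apply: continuous_comp; [exact: cvg_fst|exact: cg].
- by move=> z /E1[Ez Fz]; rewrite Ez gK /= fK.
- move=> z z' t t' Fz Fz' t01 t01' /(can_inj fK).
  by move=> /(Einj _ _ _ _ Fz Fz' t01 t01')[-> [->|/(can_inj gK) ->]]; auto.
move=> x Fx; have [U [sp [sm [[oU Ux] [cp cm] secs fib]]]] := cover _ Fx.
have cs s : {within F `&` U, continuous s} ->
    {within (g @^-1` F) `&` (g @^-1` U), continuous (f \o s \o g)}.
  move=> cs; apply: (@within_comp _ _ _ _ (F `&` U) g (f \o s)) => //.
    exact: continuous_subspaceT.
  exact: within_continuous_comp.
exists (g @^-1` U), (f \o sp \o g), (f \o sm \o g); split.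
- by split=> //; apply: open_comp => // y _; exact: cg.
- by split; exact: cs.
- move=> y Fy Uy; have [[Fp Fm Ep Em] spm] := secs _ Fy Uy.
  by rewrite /= !fK; split; [split=> //; rewrite ?Ep ?Em gK|move/(can_inj fK)].
- move=> z Fz; rewrite /= fK => Uz.
  by have [E0|E0] := fib _ Fz Uz; [left|right]; rewrite -E0 gK.
Qed.

(** Composition with [f] is a bijection from the lifts of a path to the lifts of its image. *)
Lemma transfer_homeo (Ft : set (S * R)) (q : S * R -> S * R) c :
  transfer (g @^-1` Ft) (f \o q \o g) (push f c) = push f (@transfer R _ Ft q c).
Proof.
rewrite /transfer (raddf_fglift (push f)) /push (raddf_fglift (fglift _)).
apply: eq_fglift => k _ /=; rewrite fglift1.
set A := [set h | path_in Ft h /\ q \o h = k].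
have bij : set_bij A [set h | path_in (g @^-1` Ft) h /\
    (f \o q \o g) \o h = f \o k] (fun h => f \o h).
  split.
  - move=> h [Fh qh]; split.
      by apply: path_in_comp Fh => // x; rewrite /= fK.
    by apply/funext => t; rewrite /= fK -qh.
  - move=> h h' _ _ /(congr1 (fun k => g \o k)) /=.
    by move=> E; apply/funext => t; have := congr1 (fun k => k t) E; rewrite /= !fK.
  - move=> h [Fh qh]; exists (g \o h); last by apply/funext => t; rewrite /= gK.
    split; first exact: path_in_comp Fh.
    apply/funext => t; apply: (can_inj fK).
    exact: (congr1 (fun k => k t) qh).
rewrite (reindex_fsbig _ _ _ _ bij).
have [fA|iA] := pselect (finite_set A).
  rewrite (raddf_fsbig (fglift _))//; apply: eq_fsbigr => h _.
  by rewrite /= fglift1.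
(* A sum with infinite support is 0 by convention, and no generator vanishes, so both sides are 0
   when there are infinitely many lifts. *)
have supp (G : (R -> S * R) -> {freeg (R -> S * R) / int}) :
    (forall h, G h != 0) -> \sum_(h \in A) G h = 0.
  move=> G0; apply: fsbig_dflt; rewrite (_ : _ `&` _ = A)//.
  by apply/seteqP; split=> [h []//|h Ah]; split=> //=; exact/eqP.
by rewrite !supp ?raddf0// => h; rewrite freegU_eq0.
Qed.

Lemma push_off_homeo (n : nat) (L : 'I_n -> R -> S * R) F L' :
  push_off L F L' ->
  push_off (fun i => f \o L i) (g @^-1` F) (fun i => f \o L' i).
Proof.
move=> [H [L'l cH Hb Hp [Hinj HF]]]; exists (fun i => f \o H i); split.
- move=> i; have [pL L01] := L'l i; split; last by rewrite /= L01.
  exact: path_in_comp pL.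
- by move=> i; exact: within_continuous_comp.
- by move=> i s /(Hb i)[/= -> ->].
- by move=> i t /(Hp i) /= ->.
split=> [i j s s' t t' s0 s0' t0 t0' /(can_inj fK)|i s t s0 t0 /=].
  exact: Hinj.
by rewrite fK; exact: HF.
Qed.

Lemma connected_component_homeo (F : set (S * R)) (h : S * R -> S * R) x y
    (F' : set (S * R)) : continuous h -> (forall z, F z -> F' (h z)) ->
  connected_component F x y -> connected_component F' (h x) (h y).
Proof.
move=> ch FF [C [Cx CF Cc] Cy]; exists (h @` C); last by exists y.
split; [by exists x|by move=> _ [z /CF/FF ? <-]|].
apply: connected_continuous_connected => //; exact: continuous_subspaceT.
Qed.

(** Preimage under [g] matches the components, and it is injective on sets because [g] is onto. *)
Lemma card_components_homeo (F : set (S * R)) :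
  ([set connected_component (g @^-1` F) x | x in g @^-1` F]
     #= [set connected_component F x | x in F])%card.
Proof.
have E x : connected_component (g @^-1` F) (f x) = g @^-1` connected_component F x.
  apply/seteqP; split=> y /= Fy.
    by rewrite -(fK x); exact: connected_component_homeo Fy.
  rewrite -(gK y); apply: connected_component_homeo Fy => // z.
  by rewrite /= fK.
rewrite (_ : [set _ | x in _] = [set g @^-1` A | A in
    [set connected_component F x | x in F]]); last first.
  apply/seteqP; split=> [_ [x Fx <-]|_ [_ [x Fx <-] <-]].
    by exists (connected_component F (g x)); [exists (g x)|rewrite -E gK].
  by exists (f x); rewrite /= ?fK.
apply: inj_card_eq => A B _ _ AB; rewrite -[A](image_preimage _ (f := g)).
  by rewrite AB image_preimage//; apply/seteqP; split=> // y _; exists (f y).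
by apply/seteqP; split=> // y _; exists (f y).
Qed.

End Transport.

(** * Mirror images *)

(** By injectivity [P] is a singleton exactly when its image is; otherwise both sides are the
    default [f x0]. Applied to negation, this carries the sign through the definite description of
    the signature. *)
Lemma the_image (T U : choiceType) (x0 : T) (f : T -> U) (g : U -> T)
    (P : set T) : cancel f g -> the (f x0) (f @` P) = f (the x0 P).
Proof.
move=> fK; rewrite /the.
have the1 (V : choiceType) (z0 z : V) : xget z0 [set y | [set z] = [set y]] = z.
  by apply: xget_unique => // y /= E; have : [set z] y by rewrite E.
have [[x ->]|nP] := pselect (exists x, P = [set x]).
  by rewrite image_set1 !the1.
rewrite !xgetPN// => y /= Py; apply: nP.
  by exists y.
have [x Px fxy] : (f @` P) y by rewrite Py.
exists x; apply/seteqP; split=> [z Pz|_ -> //]; apply: (can_inj fK).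
by have : (f @` P) (f z) by [exists z]; rewrite Py fxy.
Qed.

(** * Crossings and forms under orientation-reversing homeomorphisms *)

Section Reversal.
Variables (R : realType) (S : topologicalType) (O : set (R * R -> S)).
Hypothesis orO : orientation O.

Lemma open_embedding_homeo (f g : S -> S) (c : R * R -> S) :
  continuous f -> continuous g -> cancel f g -> cancel g f ->
  open_embedding c -> open_embedding (f \o c).
Proof.
move=> cf cg fK gK [cc ci co]; split.
- by move=> x; apply: continuous_comp; [exact: cc|exact: cf].
- exact: inj_comp (can_inj fK) ci.
move=> U /co oU; rewrite -image_comp (_ : _ @` _ = g @^-1` (c @` U)).
  by apply: open_comp => // y _; exact: cg.
apply/seteqP; split=> [_ [_ [x Ux <-] <-]|x [y Uy cy]].
  by exists x; rewrite //= fK.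
by exists (c y); [exists y|rewrite cy gK].
Qed.

Lemma open_embedding_reflect (c : R * R -> S) :
  open_embedding c -> open_embedding (fun v => c (v.1, - v.2)).
Proof.
pose r (v : R * R) := (v.1, - v.2).
have rK : cancel r r by case=> x y; rewrite /r/= opprK.
have cr : continuous r.
  apply: continuous_pair => x; first exact: cvg_fst.
  by apply: continuous_comp; [exact: cvg_snd|exact: opp_continuous].
move=> [cc ci co]; split.
- by move=> x; apply: (@continuous_comp _ _ _ r c); [exact: cr|exact: cc].
- exact: inj_comp ci (can_inj rK).
move=> U oU; rewrite (_ : _ @` U = c @` (r @^-1` U)).
  by apply: co; apply: open_comp => // y _; exact: cr.
apply/seteqP; split=> [_ [x Ux <-]|_ [x Ux <-]].
  by exists (r x) => //; rewrite /= rK.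
by exists (r x) => //=; rewrite opprK; case: x {Ux}.
Qed.

Variables (f g : S -> S).
Hypotheses (cf : continuous f) (cg : continuous g).
Hypotheses (fK : cancel f g) (gK : cancel g f).

(** Forms for the mirror image are pulled back along the inverse, which must therefore reverse
    orientation too; the hypothesis is applied to the chart [g \o c]. *)
Lemma orientation_reversing_inv :
  orientation_reversing O f -> orientation_reversing O g.
Proof.
move=> rf c ec; have := rf (g \o c) (open_embedding_homeo cg cf gK fK ec).
rewrite (_ : f \o (g \o c) = c); last by apply/funext => x /=; rewrite gK.
by have [|] := pselect (O (g \o c)); tauto.
Qed.

Hypothesis rf : orientation_reversing O f.

(** The image under [f] of a positive chart is negative, so its reflection is positive again; in the
    reflected chart the second strand runs along its axis in the opposite direction. *)
Lemma crossing_reversing a b s t e :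
  crossing O a b s t e -> crossing O (f \o a) (f \o b) s t (- e).
Proof.
move=> [s01 t01 e1 [c [eta [ec Oc eta0 ab]]]]; split=> //.
  by case: e1 => ->; [right|left; rewrite opprK].
have efc := open_embedding_homeo cf cg fK gK ec.
exists (fun v => f (c (v.1, - v.2))), eta; split=> //.
- exact: open_embedding_reflect efc.
- have := orO.1 _ efc; have := rf ec => /= rc rfc.
  apply: contrapT => /rfc; tauto.
move=> u /ab[/= -> ->]; rewrite oppr0; split=> //.
by rewrite intrN mulNr opprK.
Qed.

Lemma crossings_reversing a b X e :
  crossings O a b X e -> crossings O (f \o a) (f \o b) X (fun x => - e x).
Proof.
move=> [uX Xab cX]; split=> // [s t s01 t01|x /cX].
  rewrite -Xab//=; split=> [/(can_inj fK)//|-> //].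
exact: crossing_reversing.
Qed.

(** The sign compensates the reversal of every crossing, so that the pulled-back form can serve as a
    witness in [has_GL_matrix]. *)
Lemma intersection_form_reversing d : intersection_form O d ->
  intersection_form O (fun a b => - d (push f a) (push f b)).
Proof.
move=> [dP dC dX]; split.
- by apply: pairing_opp; apply: pairing_push dP.
- move=> a b ca cb; rewrite dC//; first exact: cycle1_push ca.
  exact: cycle1_push cb.
move=> a b X e la lb /crossings_reversing cX.
have lo (k : R -> S) : loop_in [set: S] k -> loop_in [set: S] (f \o k).
  by move=> [pk k01]; split; [exact: path_in_comp pk|rewrite /= k01].
rewrite !push1 (dX _ _ _ _ (lo _ la) (lo _ lb) cX).
by rewrite sumrN opprK.
Qed.

Lemma continuous_hflip (h : S -> S) : continuous h -> continuous (@hflip R S h).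
Proof.
move=> ch; apply: continuous_pair => x; last exact: cvg_snd.
by apply: continuous_comp; [exact: cvg_fst|exact: ch].
Qed.

Lemma hflipK (h k : S -> S) : cancel h k -> cancel (@hflip R S h) (hflip k).
Proof. by move=> hK [x t]; rewrite /hflip/= hK. Qed.

(** Heights are unchanged, so the same crossings are counted, each with the opposite sign. *)
Lemma linking_form_hflip l : linking_form O l ->
  linking_form O (fun a b => - l (push (hflip f) a) (push (hflip f) b)).
Proof.
move=> [lP lX].
have sub (A : set (S * R)) x : A x -> (hflip g @^-1` A) (hflip f x).
  by rewrite /= (hflipK fK).
have dis (A B : set (S * R)) : A `&` B = set0 ->
    (hflip g @^-1` A) `&` (hflip g @^-1` B) = set0.
  by move=> AB; rewrite -preimage_setI AB preimage_set0.
split=> [A B /dis/lP ABl|A B a b X e /dis AB [pa a01] [pb b01]].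
  apply: pairing_opp; apply: pairing_push ABl; try exact: sub.
  exact: continuous_hflip.
move=> /crossings_reversing cX; rewrite !push1.
rewrite (lX _ _ _ _ X (fun x => - e x) AB) ?sumrN ?opprK//.
- split; last by rewrite /= a01.
  by apply: path_in_comp pa; [exact: continuous_hflip|exact: sub].
- split; last by rewrite /= b01.
  by apply: path_in_comp pb; [exact: continuous_hflip|exact: sub].
Qed.

End Reversal.

(** * The vertical mirror image *)

Section VerticalFlip.
Variables (R : realType) (S : topologicalType) (O : set (R * R -> S)).

Lemma vflipK : involutive (@vflip R S).
Proof. by case=> x t; rewrite /vflip/= subKr. Qed.

Lemma continuous_vflip : continuous (@vflip R S).
Proof.
apply: continuous_pair => x; first exact: cvg_fst.
by apply: cvgB; [exact: cvg_cst|exact: cvg_snd].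
Qed.

Lemma push_fst_vflip (c : {freeg (R -> S * R) / int}) :
  push fst (push (@vflip R S) c) = push fst c.
Proof. by rewrite push_comp. Qed.

(* At every crossing exactly one strand is above, so the crossings counted by
   l after the flip are those that l does not count, and d counts them all. *)
Lemma linking_form_vflip l d : linking_form O l -> intersection_form O d ->
  linking_form O (fun a b => d (push fst a) (push fst b)
    - l (push (@vflip R S) a) (push (@vflip R S) b)).
Proof.
move=> [lP lX] [dP _ dX].
have sub (A : set (S * R)) x : A x -> (@vflip R S @^-1` A) (vflip x).
  by rewrite /= vflipK.
have dis (A B : set (S * R)) : A `&` B = set0 ->
    (@vflip R S @^-1` A) `&` (@vflip R S @^-1` B) = set0.
  by move=> AB; rewrite -preimage_setI AB preimage_set0.
have cfst : continuous (@fst S R) by move=> x; exact: cvg_fst.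
split=> [A B /dis/lP ABl|A B a b X e AB [pa a01] [pb b01] cX].
  apply: pairing_add; last exact: pairing_push dP.
  by apply: pairing_opp; apply: pairing_push ABl;
    [exact: continuous_vflip|exact: sub|exact: sub].
have lo (C : set (S * R)) (k : R -> S * R) : path_in C k -> k 0 = k 1 ->
    loop_in [set: S] (fst \o k) /\ loop_in (@vflip R S @^-1` C) (@vflip R S \o k).
  move=> pk k01; split; split; rewrite /= ?k01//.
    exact: path_in_comp pk.
  by apply: path_in_comp pk; [exact: continuous_vflip|exact: sub].
have [fa va] := lo A a pa a01; have [fb vb] := lo B b pb b01.
rewrite !push1 (dX _ _ _ _ fa fb cX) (lX _ _ _ _ X e (dis _ _ AB) va vb)//.
rewrite (bigID (fun x : R * R => (b x.2).2 < (a x.1).2)%R)/=.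
rewrite [X in _ + X - _](_ : _ = \sum_(x <- X |
    (1 - (b x.2).2 < 1 - (a x.1).2)%R) e x) ?addrK//.
rewrite big_seq_cond [RHS]big_seq_cond; apply: eq_bigl => -[s t] /=.
case Xst: ((s, t) \in X) => //=; rewrite ltrD2l ltrN2 -leNgt le_eqVlt.
(* Equal heights at a crossing would give a common point of the disjoint sets [A] and [B]. *)
case: eqP => //= E; exfalso.
have [_ Xab cr] := cX; have [s01 t01 _ _] := cr _ Xst.
have /= Est : (fst \o a) s = (fst \o b) t.
  apply/Xab => //.
    by case/andP: s01 => /ltW -> /ltW ->.
  by case/andP: t01 => /ltW -> /ltW ->.
have ab : a s = b t by rewrite [LHS]surjective_pairing Est E -surjective_pairing.
have : (A `&` B) (a s).
  by case: pa pb => _ _ Aa [_ _ Bb]; split; [exact: Aa|rewrite ab; exact: Bb].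
by rewrite AB.
Qed.

Let cv := @continuous_vflip.
Let vK := @vflipK.

Lemma has_GL_matrix_vflip (F : set (S * R)) (r : nat) (A : 'M[int]_r) :
  hausdorff_space S ->
  has_GL_matrix O F A -> has_GL_matrix O (@vflip R S @^-1` F) (- A).
Proof.
move=> hS [l [d [Ft [E [b [lO dO tub bas Aij]]]]]].
(* The flip does not move projections to S, so [d] is kept and only the linking form is replaced. *)
exists (fun a b => d (push fst a) (push fst b)
    - l (push (@vflip R S) a) (push (@vflip R S) b)), d,
  (@vflip R S @^-1` Ft), (fun z t => vflip (E (vflip z) t)),
  (fun i => push (@vflip R S) (b i)); split=> //.
- exact: linking_form_vflip.
- exact (tubular_homeo cv cv vK vK tub).
- exact (H1_basis_homeo cv cv vK vK bas).
move=> i j; rewrite mxE Aij.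
have -> := transfer_homeo cv cv vK vK
  Ft (fun z => E z 0) (b i).
rewrite !push_fst_vflip !(pushK vK).
have cfst : continuous (@fst S R) by move=> x; exact: cvg_fst.
have pb k : cycle1 [set: S] (push fst (b k)).
  by apply: cycle1_push (bas.1 k).
have [dP _ _] := dO.
(* With the transfer replaced by twice [b i] in S, the new entry is 2d - l - d = -(l - d). *)
have -> : d (push fst (transfer Ft (fun z => E z 0) (b i))) (push fst (b j)) =
    d (push fst (b i) + push fst (b i)) (push fst (b j)).
  apply: (pairing_homl dP) => //; first exact: cycle1D.
  by rewrite -mulr2n; exact: (transfer_homologous hS tub cfst (bas.1 i)).
case: dP => dD _ _ _; rewrite dD//.
by rewrite opprB addrAC addrK.
Qed.

(** The flipped linking form involves an intersection form, which [has_euler] does not provide;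
    hence the argument [d]. *)
Lemma has_euler_vflip (n : nat) (L : 'I_n -> R -> S * R) (F : set (S * R)) d e :
  (forall i, loop_in [set: S * R] (L i)) -> intersection_form O d ->
  has_euler O L F e ->
  has_euler O (fun i => @vflip R S \o L i) (@vflip R S @^-1` F) (- e).
Proof.
move=> Ll dO [l [L' [lO po ->]]].
exists (fun a b => d (push fst a) (push fst b)
    - l (push (@vflip R S) a) (push (@vflip R S) b)), (fun i => @vflip R S \o L' i).
split; first exact: linking_form_vflip.
  exact (push_off_homeo cv vK po).
have [dP dC _] := dO.
have pushE (M : 'I_n -> R -> S * R) :
    push (@vflip R S) (\sum_i << @vflip R S \o M i >>) = \sum_i << M i >>.
  rewrite raddf_sum/=; apply: eq_bigr => i _.
  by rewrite -push1 (pushK vK).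
rewrite !pushE.
have fstE (M : 'I_n -> R -> S * R) :
    push fst (\sum_i << @vflip R S \o M i >>) = \sum_i << fst \o M i >>.
  by rewrite raddf_sum/=; apply: eq_bigr => i _; rewrite push1.
rewrite !fstE.
have cfst : continuous (@fst S R) by move=> x; exact: cvg_fst.
have cL (M : 'I_n -> R -> S * R) : (forall i, loop_in [set: S * R] (M i)) ->
    cycle1 [set: S] (\sum_i << fst \o M i >>).
  move=> Ml; apply: cycle1_sum => i; apply: cycle1_loop.
  have [pM M01] := Ml i.
  by split; [exact: path_in_comp pM|rewrite /= M01].
(* Antisymmetry gives twice this integer as 0. *)
have d0 : d (\sum_i << fst \o L i >>) (\sum_i << fst \o L i >>) = 0.
  have := dC _ _ (cL L Ll) (cL L Ll).
  by move/eqP; rewrite -addr_eq0 -mulr2n mulrn_eq0/= => /eqP.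
suff -> : d (\sum_i << fst \o L i >>) (\sum_i << fst \o L' i >>) = 0.
  by rewrite sub0r.
have [H [L'l cH Hb Hp _]] := po.
rewrite -[RHS]d0; apply: (pairing_homr dP); [exact: cL|exact: cL|].
rewrite -sumrB; apply: boundary1_sum => i _.
(* The annulus between [L i] and [L' i], projected to S, is a square whose two vertical sides
   coincide and cancel. *)
have cK : {within @unit_square R, continuous (fst \o H i)}.
  exact: within_continuous_comp.
have := boundary1N (boundary1_square cK); congr boundary1.
have LcE (M : 'I_n -> R -> S * R) t : loop_in [set: S * R] (M i) ->
    M i (clamp t) = M i t.
  by move=> [[_ Mc _] _]; exact: (congr1 (fun k => k t) Mc).
rewrite (_ : (fun s => (fst \o H i) (clamp s, 0)) = fst \o L i); last first.
  by apply/funext => s /=; rewrite (Hb i _ (clamp01 s)).1 LcE.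
rewrite (_ : (fun s => (fst \o H i) (clamp s, 1)) = fst \o L' i); last first.
  by apply/funext => s /=; rewrite (Hb i _ (clamp01 s)).2 LcE.
rewrite (_ : (fun t => (fst \o H i) (1, clamp t)) =
  (fun t => (fst \o H i) (0, clamp t))); last first.
  by apply/funext => s /=; rewrite (Hp i _ (clamp01 s)).
by rewrite addrK opprB.
Qed.

End VerticalFlip.

(** * The horizontal mirror image *)

Section HorizontalFlip.
Variables (R : realType) (S : topologicalType) (O : set (R * R -> S)).
Variables (f g : S -> S).
Hypotheses (orO : orientation O) (cf : continuous f) (cg : continuous g).
Hypotheses (fK : cancel f g) (gK : cancel g f).
Hypothesis rf : orientation_reversing O f.

Let rg : orientation_reversing O g := orientation_reversing_inv cf cg fK gK rf.
Let cF := @continuous_hflip R S f cf.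
Let cG := @continuous_hflip R S g cg.
Let FK := @hflipK R S f g fK.
Let GK := @hflipK R S g f gK.

Lemma has_GL_matrix_hflip (F : set (S * R)) (r : nat) (A : 'M[int]_r) :
  has_GL_matrix O F A -> has_GL_matrix O (hflip g @^-1` F) (- A).
Proof.
move=> [l [d [Ft [E [b [lO dO tub bas Aij]]]]]].
(* Both forms are pulled back along the inverse: on the image basis they return the old values with
   opposite sign. *)
exists (fun a b => - l (push (hflip g) a) (push (hflip g) b)),
  (fun a b => - d (push g a) (push g b)),
  (hflip g @^-1` Ft), (fun z t => hflip f (E (hflip g z) t)),
  (fun i => push (hflip f) (b i)); split.
- exact: linking_form_hflip.
- exact: intersection_form_reversing.
- exact: tubular_homeo.
- exact: H1_basis_homeo.
move=> i j; rewrite mxE Aij.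
have -> := transfer_homeo cF cG FK GK Ft (fun z => E z 0) (b i).
have pE k : push g (push fst (push (hflip f) (b k))) = push fst (b k).
  rewrite !push_comp; congr (push _ _).
  by apply/funext => z /=; rewrite fK.
by rewrite !pE !(pushK FK) opprB opprK addrC.
Qed.

Lemma has_euler_hflip (n : nat) (L : 'I_n -> R -> S * R) (F : set (S * R)) e :
  has_euler O L F e ->
  has_euler O (fun i => hflip f \o L i) (hflip g @^-1` F) (- e).
Proof.
move=> [l [L' [lO po ->]]].
exists (fun a b => - l (push (hflip g) a) (push (hflip g) b)),
  (fun i => hflip f \o L' i); split.
- exact: linking_form_hflip.
- exact: push_off_homeo.
have pushE (M : 'I_n -> R -> S * R) :
    push (hflip g) (\sum_i << hflip f \o M i >>) = \sum_i << M i >>.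
  rewrite raddf_sum/=; apply: eq_bigr => i _.
  by rewrite -push1 (pushK FK).
by rewrite !pushE.
Qed.

End HorizontalFlip.

(** * From matrices and framing numbers to the invariants *)

Section Invariants.
Variables (R : realType) (S : topologicalType) (O : set (R * R -> S)).
Variables (n : nat) (L L' : 'I_n -> R -> S * R) (F F' : set (S * R)).
Hypothesis GL : forall r (A : 'M[int]_r),
  has_GL_matrix O F' (- A) <-> has_GL_matrix O F A.

Lemma link_det_mirror : link_det O F' = link_det O F.
Proof.
congr the; apply/seteqP; split=> [m [r [A [/= hA ->]]]|m [r [A [/= hA ->]]]].
  by exists r, (- A); rewrite absz_detN; split=> //; apply/GL; rewrite opprK.
by exists r, (- A); rewrite absz_detN; split=> //; exact/GL.
Qed.

Lemma link_nullity_mirror :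
  ([set connected_component F' x | x in F']
     #= [set connected_component F x | x in F])%card ->
  link_nullity O F' = link_nullity O F.
Proof.
move=> FF; congr the.
apply/seteqP; split=> [m [r [A [k [/= hA hk ->]]]]|m [r [A [k [/= hA hk ->]]]]].
  exists r, (- A), k; split; last by rewrite mx_nullityN.
    by apply/GL; rewrite opprK.
  by rewrite -(card_eql FF).
exists r, (- A), k; split; last by rewrite mx_nullityN.
  exact/GL.
by rewrite (card_eql FF).
Qed.

(** Framing numbers are compared only in the presence of a Gordon-Litherland matrix, from which the
    vertical case takes its intersection form. *)
Lemma link_signature_mirror :
  (forall r (A : 'M[int]_r) e, has_GL_matrix O F A ->
    has_euler O L' F' (- e) <-> has_euler O L F e) ->
  link_signature O L' F' = - link_signature O L F.
Proof.
(* The default 0 is written as -0 so that negation can be moved out of the description. *)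
move=> eul; rewrite /link_signature -[X in the X](oppr0 rat).
rewrite -(the_image 0 _ (@opprK rat)); congr the.
have sgN r (A : 'M[int]_r) (e : int) :
    (mx_signature (- A))%:~R + (- e)%:~R / 2 =
    - ((mx_signature A)%:~R + e%:~R / 2) :> rat.
  by rewrite mx_signatureN !intrN mulNr opprD.
apply/seteqP; split=> [s [r [A [e [/= hA he ->]]]]|_ [s [r [A [e [/= hA he ->]]]] <-]].
  exists (- ((mx_signature A)%:~R + e%:~R / 2)); last by rewrite opprK.
  have hNA : has_GL_matrix O F (- A) by apply/GL; rewrite opprK.
  exists r, (- A), (- e); rewrite sgN; split=> //.
  by apply/(eul _ _ _ hNA); rewrite opprK.
exists r, (- A), (- e); rewrite sgN; split=> //; first exact/GL.
exact/(eul _ _ _ hA).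
Qed.

End Invariants.

Theorem proposition5p7 (R : realType) (S : topologicalType)
    (O : set (R * R -> S)) (n : nat) (L : 'I_n -> R -> S * R)
    (F : set (S * R)) :
  closed_connected_surface R S -> orientation O ->
  oriented_link L -> spanning_surface L F ->
  [/\ link_signature O (fun i => @vflip R S \o L i) (@vflip R S @` F)
        = - link_signature O L F,
      link_det O (@vflip R S @` F) = link_det O F &
      link_nullity O (@vflip R S @` F) = link_nullity O F] /\
  (forall f : S -> S, homeomorphism f -> orientation_reversing O f ->
    [/\ link_signature O (fun i => @hflip R S f \o L i) (@hflip R S f @` F)
          = - link_signature O L F,
        link_det O (@hflip R S f @` F) = link_det O F &
        link_nullity O (@hflip R S f @` F) = link_nullity O F]).
Proof.
move=> [hS _ _ _] orO [Ll _] _; split=> [|f [cf [g [cg fK gK]]] rf].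
  have vK := @vflipK R S; have cv := @continuous_vflip R S.
  rewrite (image_homeo vK vK).
  (* Flipping twice restores [F], so the one-way transport lemmas become equivalences. *)
  have FE : @vflip R S @^-1` (@vflip R S @^-1` F) = F.
    by apply/funext => z /=; rewrite vK.
  have GL r (A : 'M[int]_r) :
      has_GL_matrix O (@vflip R S @^-1` F) (- A) <-> has_GL_matrix O F A.
    split; last exact: has_GL_matrix_vflip.
    by move/(has_GL_matrix_vflip hS); rewrite opprK FE.
  have LT i : loop_in [set: S * R] (L i).
    by have [[cL Lc _] L01] := Ll i.
  split; [|exact: link_det_mirror|]; last first.
    apply: link_nullity_mirror => //.
    exact (card_components_homeo cv cv vK vK F).
  apply: link_signature_mirror => // r A e [_ [d [_ [_ [_ [_ dO _ _ _]]]]]].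
  split; last exact: (has_euler_vflip LT dO).
  have LT' i : loop_in [set: S * R] (@vflip R S \o L i).
    have [pL L01] := LT i; split; last by rewrite /= L01.
    exact: path_in_comp pL.
  move/(has_euler_vflip LT' dO); rewrite opprK FE.
  rewrite (_ : (fun i => _ \o (_ \o L i)) = L)//.
  by apply/funext => i; apply/funext => t /=; rewrite vK.
have rg := orientation_reversing_inv cf cg fK gK rf.
have [FK GK] := (hflipK (R := R) fK, hflipK (R := R) gK).
rewrite (image_homeo FK GK).
have FE : @hflip R S f @^-1` (@hflip R S g @^-1` F) = F.
  by apply/funext => z; rewrite /= /preimage/= FK.
have GL r (A : 'M[int]_r) :
    has_GL_matrix O (@hflip R S g @^-1` F) (- A) <-> has_GL_matrix O F A.
  split; last exact: (has_GL_matrix_hflip orO cf cg fK gK rf).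
  (* The converse is the same transport with [f] and [g] exchanged. *)
  by move/(has_GL_matrix_hflip orO cg cf gK fK rg); rewrite opprK FE.
split; [|exact: link_det_mirror|]; last first.
  apply: link_nullity_mirror => //.
  exact (card_components_homeo (continuous_hflip cf) (continuous_hflip cg) FK GK F).
apply: link_signature_mirror => // r A e _.
split; last exact: (has_euler_hflip orO cf cg fK gK rf).
move/(has_euler_hflip orO cg cf gK fK rg); rewrite opprK FE.
rewrite (_ : (fun i => _ \o (_ \o L i)) = L)//.
by apply/funext => i; apply/funext => t /=; rewrite FK.
Qed.
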